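(* Let $X$ be a CBB$(0)$ space, let $Y$ be a complete CAT$(0)$ space and let $A \subseteq X$ be nonempty. Then the multivalued mapping $\Psi : \mathcal{L}(A,Y) \to \mathcal{P}(\mathcal{L}(X,Y))$, which assigns to each $f \in \mathcal{L}(A,Y)$ the set of all $f' \in \mathcal{L}(X,Y)$ with $f'|_A = f$ and $\mathrm{Lip}(f',X)=\mathrm{Lip}(f,A)$, is lower semi-continuous (with respect to the supremum metrics).
   Context: A geodesic space is a metric space in which any two points are joined by a geodesic segment. A geodesic space is CAT$(0)$ if every geodesic triangle is ''thinner'' than its Euclidean comparison triangle (distances between points on the triangle are $\le$ distances between corresponding points of the comparison triangle in $\mathbb{R}^2$), and CBB$(0)$ (curvature bounded below by $0$ in the sense of Alexandrov) if the reversed inequality ($\ge$) holds for all geodesic triangles. For metric spaces $A,Y$, $\mathcal{L}(A,Y)$ is the set of bounded Lipschitz mappings $A\to Y$ with the supremum metric $d_\infty(f,g)=\sup_{x\in A}d_Y(f(x),g(x))$, and for $B\subseteq A$, $\mathrm{Lip}(f,B)=\sup\{d_Y(f(x),f(y))/d(x,y): x,y\in B, x\neq y\}$. $\mathcal{P}(C)$ is the power set of $C$. A multivalued map $\Gamma:U\to\mathcal{P}(Z)$ is lower semi-continuous if $\{u:\Gamma(u)\cap V\ne\emptyset\}$ is open for every open $V\subseteq Z$. *)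

(* Defs.v *)
From Stdlib Require Import Reals.
From Coquelicot Require Import Coquelicot.
Open Scope R_scope.

Section Metric.
Context {T : Type} (d : T -> T -> R).

Definition is_metric : Prop :=
  (forall x y, 0 <= d x y) /\ (forall x y, d x y = 0 <-> x = y) /\
  (forall x y, d x y = d y x) /\ (forall x y z, d x z <= d x y + d y z).

Definition geodesic (x y : T) (g : R -> T) : Prop :=
  g 0 = x /\ g (d x y) = y /\
  forall s t, 0 <= s <= d x y -> 0 <= t <= d x y -> d (g s) (g t) = Rabs (s - t).

Definition geodesic_space : Prop :=
  forall x y, exists g, geodesic x y g.

Definition dE (a b : R * R) : R :=
  sqrt ((fst a - fst b)^2 + (snd a - snd b)^2).

(** z = g s is a point of the side [x,y] (parametrised by the geodesic g)
    and w is its comparison point on the side [a,b] of the comparison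
    triangle (the point at distance s from a). *)
Definition side_pt (x y : T) (g : R -> T) (a b : R * R) (z : T) (w : R * R) : Prop :=
  exists s, 0 <= s <= d x y /\ z = g s /\
    w = (fst a + s / d x y * (fst b - fst a), snd a + s / d x y * (snd b - snd a)).

Definition tri_pt (p q r : T) (g1 g2 g3 : R -> T) (a b c : R * R)
  (z : T) (w : R * R) : Prop :=
  side_pt p q g1 a b z w \/ side_pt q r g2 b c z w \/ side_pt r p g3 c a z w.

Definition comparison_config (p q r : T) (g1 g2 g3 : R -> T) (a b c : R * R) : Prop :=
  geodesic p q g1 /\ geodesic q r g2 /\ geodesic r p g3 /\
  dE a b = d p q /\ dE b c = d q r /\ dE c a = d r p.

Definition CAT0 : Prop :=
  geodesic_space /\
  forall p q r g1 g2 g3 a b c, comparison_config p q r g1 g2 g3 a b c ->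
  forall z w z' w', tri_pt p q r g1 g2 g3 a b c z w ->
    tri_pt p q r g1 g2 g3 a b c z' w' -> d z z' <= dE w w'.

Definition CBB0 : Prop :=
  geodesic_space /\
  forall p q r g1 g2 g3 a b c, comparison_config p q r g1 g2 g3 a b c ->
  forall z w z' w', tri_pt p q r g1 g2 g3 a b c z w ->
    tri_pt p q r g1 g2 g3 a b c z' w' -> d z z' >= dE w w'.

Definition complete : Prop :=
  forall u : nat -> T,
    (forall eps, 0 < eps -> exists N, forall m n, (N <= m)%nat -> (N <= n)%nat ->
        d (u m) (u n) < eps) ->
    exists l, forall eps, 0 < eps -> exists N, forall n, (N <= n)%nat -> d (u n) l < eps.

Definition open_wrt (D : T -> T -> Rbar) (U : T -> Prop) : Prop :=
  forall u, U u -> exists eps, 0 < eps /\ forall v, Rbar_lt (D u v) (Finite eps) -> U v.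

End Metric.

Section Maps.
Context {S Y : Type} (dS : S -> S -> R) (dY : Y -> Y -> R).

(** Lip(f, S) = sup of the ratios d(f x, f y)/d(x, y), x <> y
    (with the convention sup over no pairs = 0, i.e. 0 is included). *)
Definition Lip (f : S -> Y) : Rbar :=
  Lub_Rbar (fun r => r = 0 \/
    exists x y, x <> y /\ r = dY (f x) (f y) / dS x y).

Definition bounded_lipschitz (f : S -> Y) : Prop :=
  (exists M, forall x y, dY (f x) (f y) <= M) /\
  (exists K, forall x y, dY (f x) (f y) <= K * dS x y).

Definition LipSpace : Type := { f : S -> Y | bounded_lipschitz f }.

Definition d_inf (f g : LipSpace) : Rbar :=
  Lub_Rbar (fun r => exists x, r = dY (proj1_sig f x) (proj1_sig g x)).

End Maps.

Definition dsub {X : Type} (dX : X -> X -> R) (A : X -> Prop) (a b : {x | A x}) : R :=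
  dX (proj1_sig a) (proj1_sig b).

Definition Psi {X Y : Type} (dX : X -> X -> R) (dY : Y -> Y -> R) (A : X -> Prop)
  (f : LipSpace (dsub dX A) dY) (f' : LipSpace dX dY) : Prop :=
  (forall a : {x | A x}, proj1_sig f' (proj1_sig a) = proj1_sig f a) /\
  Lip dX dY (proj1_sig f') = Lip (dsub dX A) dY (proj1_sig f).

Definition lsc {U Z : Type} (dU : U -> U -> Rbar) (dZ : Z -> Z -> Rbar)
  (Gamma : U -> Z -> Prop) : Prop :=
  forall V : Z -> Prop, open_wrt dZ V ->
    open_wrt dU (fun u => exists z, Gamma u z /\ V z).

(* Main.v *)
Require Import Defs.
From Stdlib Require Import Reals Lra Psatz List Classical.
From Coquelicot Require Import Coquelicot.
From mathcomp Require boolp classical_sets.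
Open Scope R_scope.

(** Rescale [X] by [Lip g]. The sets [A * {0}], carrying a map [g] close to [f],
    and [X * {tau}], carrying [f'] slightly contracted towards a point so that its
    Lipschitz constant does not exceed that of [g], lie in [X * R], and together
    the two maps are 1-Lipschitz there; boundedness of [f'] is what absorbs the
    error between [f] and [g] at large distances. A Kirszbraun extension to
    [X * R], restricted to [X * {0}], extends [g] and stays [tau]-close to the
    contraction of [f'].

    For Kirszbraun's theorem, the source enters only through the
    Lang-Schroeder-Sturm inequality, i.e. positivity on nonnegative weights of the
    comparison Gram matrices [<x_i, x_j>_p], which passes to the product with [R].
    At a point [p] inside a geodesic towards [x_1] it follows by induction on the
    number of points: after contracting everything towards [p] by a factor [s], the
    points [x_1] and [x_2] can be replaced by their barycentre at the cost of an
    error [O(s ^ 3)], against the scale [s ^ 2] of the inequality. In the target,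
    a common point of the balls of centres [y_i] and radii [r_i] is the limit of the
    barycentres of a maximising sequence of convex combinations of the functions
    [z |-> d z y_i ^ 2 - r_i ^ 2]; no compactness is needed. *)

(** * Small error terms, weighted finite sums and their quadratic forms *)

Lemma Rle_of_forall_small (a b K t0 : R) :
  0 < t0 -> (forall t, 0 < t < t0 -> a <= b + K * t) -> a <= b.
Proof.
  intros Ht0 H.
  destruct (Rle_lt_dec a b) as [h|h]; [exact h|].
  pose proof (Rabs_pos K) as HK. pose proof (Rle_abs K) as HK'.
  set (t := Rmin (t0 / 2) ((a - b) / (2 * (Rabs K + 1)))).
  assert (Hpos : 0 < (a - b) / (2 * (Rabs K + 1))) by (apply Rdiv_lt_0_compat; lra).
  assert (Ht : 0 < t) by (unfold t; apply Rmin_glb_lt; lra).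
  assert (Ht1 : t <= t0 / 2) by apply Rmin_l.
  assert (Ht2 : t <= (a - b) / (2 * (Rabs K + 1))) by apply Rmin_r.
  assert (Ht3 : t * (2 * (Rabs K + 1)) <= a - b).
  { replace (a - b) with ((a - b) / (2 * (Rabs K + 1)) * (2 * (Rabs K + 1))) by (field; lra).
    apply Rmult_le_compat_r; lra. }
  assert (a <= b + K * t) by (apply H; lra).
  assert (K * t <= Rabs K * t) by (apply Rmult_le_compat_r; lra).
  nra.
Qed.

Section WeightedSums.
Context {I : Type}.
Implicit Types (L : list (R * I)) (f g : I -> R) (k : I -> I -> R).

Definition wsum L f : R :=
  fold_right (fun wx acc => fst wx * f (snd wx) + acc) 0 L.

Definition nonneg L : Prop := List.Forall (fun wx => 0 <= fst wx) L.

Definition qform k L : R := wsum L (fun x => wsum L (k x)).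

Definition rescale (c : R) L : list (R * I) :=
  map (fun wx => (c * fst wx, snd wx)) L.

Lemma wsum_ext L f g : (forall x, f x = g x) -> wsum L f = wsum L g.
Proof.
  intros H; induction L as [|[w x] L IH]; simpl; [reflexivity|].
  now rewrite H, IH.
Qed.

Lemma wsum_plus L f g : wsum L (fun x => f x + g x) = wsum L f + wsum L g.
Proof. induction L as [|[w x] L IH]; simpl; [|rewrite IH]; ring. Qed.

Lemma wsum_scal L c f : wsum L (fun x => c * f x) = c * wsum L f.
Proof. induction L as [|[w x] L IH]; simpl; [|rewrite IH]; ring. Qed.

Lemma wsum_const L c : wsum L (fun _ => c) = c * wsum L (fun _ => 1).
Proof. induction L as [|[w x] L IH]; simpl; [|rewrite IH]; ring. Qed.

Lemma wsum_app L1 L2 f : wsum (L1 ++ L2) f = wsum L1 f + wsum L2 f.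
Proof. induction L1 as [|[w x] L IH]; simpl; [|rewrite IH]; ring. Qed.

Lemma wsum_rescale c L f : wsum (rescale c L) f = c * wsum L f.
Proof. induction L as [|[w x] L IH]; simpl; [|rewrite IH]; ring. Qed.

Lemma wsum_le L f g : nonneg L -> (forall x, f x <= g x) -> wsum L f <= wsum L g.
Proof.
  intros HL H; induction HL as [|[w x] L Hw HL IH]; simpl in *; [lra|].
  apply Rplus_le_compat; [apply Rmult_le_compat_l|]; auto.
Qed.

Lemma wsum_nonneg L f : nonneg L -> (forall x, 0 <= f x) -> 0 <= wsum L f.
Proof.
  intros HL H. replace 0 with (wsum L (fun _ => 0)) by (rewrite wsum_const; ring).
  now apply wsum_le.
Qed.

Lemma nonneg_cons w x L : 0 <= w -> nonneg L -> nonneg ((w, x) :: L).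
Proof. now constructor. Qed.

Lemma nonneg_app L1 L2 : nonneg L1 -> nonneg L2 -> nonneg (L1 ++ L2).
Proof. intros; apply Forall_app; auto. Qed.

Lemma nonneg_rescale c L : 0 <= c -> nonneg L -> nonneg (rescale c L).
Proof.
  intros Hc HL; unfold nonneg, rescale; apply Forall_map.
  eapply Forall_impl; [|exact HL]; intros [w x]; simpl; intros; nra.
Qed.

Lemma qform_le k1 k2 L :
  nonneg L -> (forall x y, k1 x y <= k2 x y) -> qform k1 L <= qform k2 L.
Proof. intros HL H; apply wsum_le; [exact HL|]; intros x; now apply wsum_le. Qed.

Lemma qform_ext k1 k2 L : (forall x y, k1 x y = k2 x y) -> qform k1 L = qform k2 L.
Proof. intros H; apply wsum_ext; intros x; now apply wsum_ext. Qed.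

Lemma qform_plus k1 k2 L :
  qform (fun x y => k1 x y + k2 x y) L = qform k1 L + qform k2 L.
Proof.
  unfold qform; rewrite <- wsum_plus.
  apply wsum_ext; intros x; apply wsum_plus.
Qed.

Lemma qform_scal c k L : qform (fun x y => c * k x y) L = c * qform k L.
Proof.
  unfold qform; rewrite <- wsum_scal.
  apply wsum_ext; intros x; apply wsum_scal.
Qed.

Lemma qform_mul f L : qform (fun x y => f x * f y) L = wsum L f * wsum L f.
Proof.
  unfold qform; rewrite <- wsum_scal.
  apply wsum_ext; intros x; rewrite wsum_scal; ring.
Qed.

Lemma qform_l f L : qform (fun x _ => f x) L = wsum L (fun _ => 1) * wsum L f.
Proof.
  unfold qform; rewrite <- wsum_scal.
  apply wsum_ext; intros x; rewrite wsum_const; ring.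
Qed.

Lemma qform_cons k w x L : (forall y z, k y z = k z y) ->
  qform k ((w, x) :: L) = w ^ 2 * k x x + 2 * w * wsum L (k x) + qform k L.
Proof.
  intros Hk; unfold qform; simpl.
  rewrite wsum_plus, wsum_scal, (wsum_ext L (fun y => k y x) (k x)) by auto.
  ring.
Qed.

End WeightedSums.

Lemma wsum_map {I J : Type} (h : I -> J) (L : list (R * I)) (f : J -> R) :
  wsum (map (fun wx => (fst wx, h (snd wx))) L) f = wsum L (fun x => f (h x)).
Proof. induction L as [|[w x] L IH]; simpl; [|rewrite IH]; ring. Qed.

Lemma nonneg_map {I J : Type} (h : I -> J) (L : list (R * I)) :
  nonneg L -> nonneg (map (fun wx => (fst wx, h (snd wx))) L).
Proof. intros HL; now apply Forall_map. Qed.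

Lemma qform_map {I J : Type} (h : I -> J) (L : list (R * I)) (k : J -> J -> R) :
  qform k (map (fun wx => (fst wx, h (snd wx))) L) = qform (fun x y => k (h x) (h y)) L.
Proof.
  unfold qform; rewrite wsum_map.
  apply wsum_ext; intros x; apply wsum_map.
Qed.

(** * Euclidean comparison triangles and Stewart's formula *)

Lemma dE_sq (a b : R * R) : dE a b ^ 2 = (fst a - fst b) ^ 2 + (snd a - snd b) ^ 2.
Proof.
  unfold dE; rewrite <- Rsqr_pow2; apply Rsqr_sqrt, Rplus_le_le_0_compat; apply pow2_ge_0.
Qed.

Lemma dE_nonneg (a b : R * R) : 0 <= dE a b.
Proof. apply sqrt_pos. Qed.

Lemma dE_stewart (a b c : R * R) (t : R) :
  dE a (fst b + t * (fst c - fst b), snd b + t * (snd c - snd b)) ^ 2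
  = (1 - t) * dE a b ^ 2 + t * dE a c ^ 2 - t * (1 - t) * dE b c ^ 2.
Proof. rewrite !dE_sq; simpl; ring. Qed.

Lemma comparison_triangle (A B C : R) :
  0 <= A -> 0 <= B -> 0 <= C -> A <= B + C -> B <= A + C -> C <= A + B ->
  exists a b c, dE a b = A /\ dE b c = B /\ dE c a = C.
Proof.
  intros HA HB HC H1 H2 H3.
  assert (eqsq : forall a b r, 0 <= r -> dE a b ^ 2 = r ^ 2 -> dE a b = r).
  { intros a b r Hr E; pose proof (dE_nonneg a b); nra. }
  destruct (Req_dec B 0) as [->|HB0].
  - exists (A, 0), (0, 0), (0, 0).
    repeat split; apply eqsq; auto; rewrite dE_sq; simpl; try ring.
    replace C with A by lra; ring.
  (* With [b] at the origin and [c = (B, 0)], the law of cosines gives the abscissa [u] of [a];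
     Heron's factorisation yields [u ^ 2 <= A ^ 2]. *)
  - set (u := (A ^ 2 + B ^ 2 - C ^ 2) / (2 * B)).
    assert (Hu : u * (2 * B) = A ^ 2 + B ^ 2 - C ^ 2) by (unfold u; field; auto).
    assert (Huu : 0 <= A ^ 2 - u ^ 2).
    { assert (0 <= (2 * B) ^ 2 * (A ^ 2 - u ^ 2)).
      { replace ((2 * B) ^ 2 * (A ^ 2 - u ^ 2))
          with ((2 * A * B - u * (2 * B)) * (2 * A * B + u * (2 * B))) by ring.
        rewrite Hu. apply Rmult_le_pos; nra. }
      assert (0 < (2 * B) ^ 2) by (assert (0 < B) by lra; nra).
      nra. }
    pose proof (sqrt_sqrt _ Huu) as Hv.
    exists (u, sqrt (A ^ 2 - u ^ 2)), (0, 0), (B, 0).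
    repeat split; apply eqsq; auto; rewrite dE_sq; cbn [fst snd]; try nra.
Qed.

Section Metric.
Context {T : Type} (d : T -> T -> R) (Hd : is_metric d).

Lemma dist_nonneg x y : 0 <= d x y.
Proof. apply Hd. Qed.
Lemma dist_refl x : d x x = 0.
Proof. now apply Hd. Qed.
Lemma dist_eq x y : d x y = 0 -> x = y.
Proof. apply Hd. Qed.
Lemma dist_sym x y : d x y = d y x.
Proof. apply Hd. Qed.
Lemma dist_triangle x y z : d x z <= d x y + d y z.
Proof. apply Hd. Qed.

(** Stewart's formula for the squared Euclidean distance from [p] to the point at the fraction [t]
    of the side from [q] to [r]. *)
Definition stewart (p q r : T) (t : R) : R :=
  (1 - t) * d p q ^ 2 + t * d p r ^ 2 - t * (1 - t) * d q r ^ 2.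

Lemma geodesic_dist (x y : T) (g : R -> T) (s t : R) :
  geodesic d x y g -> 0 <= s <= t -> t <= d x y -> d (g s) (g t) = t - s.
Proof.
  intros (_ & _ & H) Hs Ht.
  rewrite H by lra. rewrite Rabs_minus_sym. apply Rabs_pos_eq; lra.
Qed.

(** Both curvature conditions are used only for a vertex and a point of the opposite side; this is
    their common part. *)
Lemma exists_side_comparison (p q r : T) (g : R -> T) (t : R) :
  geodesic_space d -> geodesic d q r g -> 0 <= t <= 1 ->
  exists g1 g3 a b c w, comparison_config d p q r g1 g g3 a b c /\
    tri_pt d p q r g1 g g3 a b c p a /\
    tri_pt d p q r g1 g g3 a b c (g (t * d q r)) w /\
    dE a w ^ 2 = stewart p q r t.
Proof.
  intros Hgeo Hg Ht.
  destruct (Hgeo p q) as [g1 Hg1]. destruct (Hgeo r p) as [g3 Hg3].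
  destruct (comparison_triangle (d p q) (d q r) (d r p)) as (a & b & c & E1 & E2 & E3);
    try apply dist_nonneg.
  { rewrite (dist_sym q r), (dist_sym r p), Rplus_comm; apply dist_triangle. }
  { rewrite (dist_sym p q), (dist_sym r p); apply dist_triangle. }
  { rewrite (dist_sym r p); apply dist_triangle. }
  exists g1, g3, a, b, c,
    (fst b + t * (fst c - fst b), snd b + t * (snd c - snd b)).
  pose proof (dist_nonneg p q) as Hpq. pose proof (dist_nonneg q r) as Hqr.
  split; [now repeat split; try apply Hg1; try apply Hg; try apply Hg3|].
  split; [|split].
  - left; exists 0; repeat split; try lra.
    + symmetry; apply Hg1.
    + destruct a; simpl; f_equal; unfold Rdiv; ring.
  - right; left; exists (t * d q r); split; [nra|split; [reflexivity|]].
    destruct (Req_dec (d q r) 0) as [E|E].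
    + assert (Hbc : b = c).
      { rewrite E in E2. pose proof (dE_sq b c) as Hsq; rewrite E2 in Hsq.
        assert (forall u v, 0 = u ^ 2 + v ^ 2 -> u = 0) as Hz by (intros; nra).
        destruct b as [b1 b2], c as [c1 c2]; cbn [fst snd] in *; f_equal; apply Rminus_diag_uniq;
          [apply (Hz _ (b2 - c2)) | apply (Hz _ (b1 - c1))]; lra. }
      subst c; f_equal; ring.
    + replace (t * d q r / d q r) with t by (now field). reflexivity.
  - assert (Hac : dE a c = d p r) by (rewrite (dist_sym p r), <- E3; unfold dE; f_equal; ring).
    rewrite dE_stewart, E1, E2, Hac; reflexivity.
Qed.

End Metric.

(** The geodesic from [q] to [r] is fixed before [p], which affects only the other two sides, so one
    [m] serves every [p]. *)
Lemma CAT0_stewart {T : Type} (d : T -> T -> R) :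
  is_metric d -> CAT0 d -> forall q r t, 0 <= t <= 1 ->
  exists m, forall p, d p m ^ 2 <= stewart d p q r t.
Proof.
  intros Hd [Hgeo Hcat] q r t Ht.
  destruct (Hgeo q r) as [g Hg].
  exists (g (t * d q r)); intros p.
  destruct (exists_side_comparison d Hd p q r g t Hgeo Hg Ht)
    as (g1 & g3 & a & b & c & w & Hc & Hp & Hm & E).
  rewrite <- E; apply pow_incr; split; [now apply dist_nonneg|].
  exact (Hcat _ _ _ _ _ _ _ _ _ Hc _ _ _ _ Hp Hm).
Qed.

(** * Nonnegative curvature: positivity of comparison Gram matrices *)

Section NonnegativeCurvature.
Context {X : Type} (d : X -> X -> R) (Hd : is_metric d) (Hcbb : CBB0 d).

Lemma CBB0_stewart p q r g t : geodesic d q r g -> 0 <= t <= 1 ->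
  stewart d p q r t <= d p (g (t * d q r)) ^ 2.
Proof.
  intros Hg Ht. destruct Hcbb as [Hgeo Hcmp].
  destruct (exists_side_comparison d Hd p q r g t Hgeo Hg Ht)
    as (g1 & g3 & a & b & c & w & Hc & Hp & Hm & E).
  rewrite <- E; apply pow_incr; split; [apply dE_nonneg|].
  apply Rge_le; exact (Hcmp _ _ _ _ _ _ _ _ _ Hc _ _ _ _ Hp Hm).
Qed.

(** Concavity of [d p (g s) ^ 2 - s ^ 2] in [s], with denominators cleared so that parameters may
    coincide. *)
Lemma CBB0_along_geodesic x y g p s1 s2 s3 :
  geodesic d x y g -> 0 <= s1 <= s2 -> s2 <= s3 <= d x y ->
  (s3 - s2) * d p (g s1) ^ 2 + (s2 - s1) * d p (g s3) ^ 2
    - (s3 - s2) * (s2 - s1) * (s3 - s1)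
  <= (s3 - s1) * d p (g s2) ^ 2.
Proof.
  intros Hg H1 H2.
  destruct (Req_dec s1 s3) as [E|Hne].
  { replace s2 with s1 by lra; replace s3 with s1 by lra; lra. }
  assert (D : d (g s1) (g s3) = s3 - s1) by (eapply geodesic_dist; eauto; lra).
  assert (Hsub : geodesic d (g s1) (g s3) (fun u => g (s1 + u))).
  { split; [|split].
    - f_equal; ring.
    - rewrite D; f_equal; ring.
    - rewrite D; intros u v Hu Hv; destruct Hg as (_ & _ & Hg).
      rewrite Hg by lra; f_equal; ring. }
  assert (Ht : 0 <= (s2 - s1) / (s3 - s1) <= 1).
  { split; [apply Rdiv_le_0_compat; lra|].
    apply Rmult_le_reg_r with (s3 - s1); [lra|].
    unfold Rdiv; rewrite Rmult_assoc, Rinv_l; lra. }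
  pose proof (CBB0_stewart p _ _ _ _ Hsub Ht) as H; cbv beta in H.
  replace (s1 + (s2 - s1) / (s3 - s1) * d (g s1) (g s3)) with s2 in H
    by (rewrite D; field; lra).
  apply (Rmult_le_compat_l (s3 - s1)) in H; [|lra].
  eapply Rle_trans; [|exact H]; unfold stewart; rewrite D; right; field; lra.
Qed.

Lemma CBB0_contract p x t : 0 <= t <= 1 ->
  exists m, d p m = t * d p x /\ d m x = (1 - t) * d p x /\
    forall z, stewart d z p x t <= d z m ^ 2.
Proof.
  intros Ht; destruct (proj1 Hcbb p x) as [g Hg].
  pose proof (dist_nonneg d Hd p x) as Hpx.
  exists (g (t * d p x)); split; [|split].
  - rewrite <- (proj1 Hg) at 1.
    rewrite (geodesic_dist d p x g 0 (t * d p x)); [ring|exact Hg| |]; nra.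
  - transitivity (d (g (t * d p x)) (g (d p x))); [f_equal; symmetry; apply Hg|].
    rewrite (geodesic_dist d p x g (t * d p x) (d p x)); [ring|exact Hg| |]; nra.
  - intros z; now apply CBB0_stewart.
Qed.

(** The Euclidean inner product of the vectors [px] and [py] in the
    comparison triangle of [p], [x], [y]. *)
Definition gram (p x y : X) : R := (d p x ^ 2 + d p y ^ 2 - d x y ^ 2) / 2.

Lemma gram_sym p x y : gram p x y = gram p y x.
Proof. unfold gram; rewrite (dist_sym d Hd x y); field. Qed.

Lemma gram_diag p x : gram p x x = d p x ^ 2.
Proof. unfold gram; rewrite (dist_refl d Hd x); field. Qed.

Lemma gram_base p x : gram p p x = 0.
Proof. unfold gram; rewrite (dist_refl d Hd p); field. Qed.

(** Moving the two points one after the other, Stewart's inequality gives [d x' y' >= t * d x y],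
    while the distances from [p] scale exactly by [t]. *)
Lemma gram_contract p x y x' y' t : 0 <= t <= 1 ->
  d p x' = t * d p x -> d p y' = t * d p y ->
  (forall z, stewart d z p x t <= d z x' ^ 2) ->
  (forall z, stewart d z p y t <= d z y' ^ 2) ->
  gram p x' y' <= t ^ 2 * gram p x y.
Proof.
  intros Ht Ex Ey Hx Hy. unfold gram; rewrite Ex, Ey.
  pose proof (Hy x') as H1; pose proof (Hx y) as H2; unfold stewart in *.
  rewrite (dist_sym d Hd x' p), Ex in H1.
  rewrite (dist_sym d Hd y p), (dist_sym d Hd y x), (dist_sym d Hd y x') in H2.
  assert (t * ((1 - t) * d p y ^ 2 + t * d x y ^ 2 - t * (1 - t) * d p x ^ 2)
          <= t * d x' y ^ 2) by (apply Rmult_le_compat_l; lra).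
  nra.
Qed.

(** The Euclidean identity |y|^2 - 2|y - q|^2 + |y - 2q|^2 = 2|q|^2 holds up to
    third order near an interior point of a geodesic: concavity of
    [d y (g u) ^ 2 - u ^ 2] bounds its second difference by the difference of
    its slopes over the two ends of the geodesic, which the triangle inequality
    between the end points controls. *)
Lemma interior_second_difference p x g y a b S :
  geodesic d p x g -> d p x = b + a -> 0 < a -> 0 < b -> 0 <= S -> 2 * S <= a ->
  2 * d y (g (b + S)) ^ 2 + 2 * S ^ 2 - d y (g b) ^ 2 - d y (g (b + 2 * S)) ^ 2
  <= 2 * S * d y (g b) ^ 2 * (/ a + / b).
Proof.
  intros Hg D Ha Hb HS HSa.
  pose proof (CBB0_along_geodesic _ _ _ y 0 b (b + S) Hg ltac:(lra) ltac:(lra)) as H1.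
  pose proof (CBB0_along_geodesic _ _ _ y b (b + 2 * S) (b + a) Hg ltac:(lra) ltac:(lra)) as H2.
  rewrite <- D in H2 at 2.
  rewrite (proj1 Hg) in H1; rewrite (proj1 (proj2 Hg)) in H2.
  pose proof (dist_triangle d Hd p y x) as Htri; rewrite (dist_sym d Hd p y), D in Htri.
  set (u := d y x) in *; set (v := d y p) in *; set (Y := d y (g b) ^ 2) in *.
  set (Q := d y (g (b + S)) ^ 2) in *; set (Q2 := d y (g (b + 2 * S)) ^ 2) in *.
  assert (K1 : Q <= Y + S * / b * (Y - v ^ 2) + S * (b + S)).
  { apply Rmult_le_reg_l with b; [exact Hb|].
    replace (b * (Y + S * / b * (Y - v ^ 2) + S * (b + S)))
      with (b * Y + S * (Y - v ^ 2) + b * S * (b + S)) by (field; lra).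
    nra. }
  assert (K2 : Y + 2 * S * / a * (u ^ 2 - Y) - 2 * S * (a - 2 * S) <= Q2).
  { apply Rmult_le_reg_l with a; [exact Ha|].
    replace (a * (Y + 2 * S * / a * (u ^ 2 - Y) - 2 * S * (a - 2 * S)))
      with (a * Y + 2 * S * (u ^ 2 - Y) - 2 * S * (a - 2 * S) * a) by (field; lra).
    nra. }
  (* Expanding around [v = b] and [u = a] leaves squares and [a + b <= u + v], the triangle
     inequality through [y]. *)
  assert (K3 : a + b <= / b * v ^ 2 + / a * u ^ 2).
  { replace (/ b * v ^ 2) with (/ b * (v - b) ^ 2 + 2 * v - b) by (field; lra).
    replace (/ a * u ^ 2) with (/ a * (u - a) ^ 2 + 2 * u - a) by (field; lra).
    assert (0 <= / b * (v - b) ^ 2)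
      by (apply Rmult_le_pos; [left; now apply Rinv_0_lt_compat|apply pow2_ge_0]).
    assert (0 <= / a * (u - a) ^ 2)
      by (apply Rmult_le_pos; [left; now apply Rinv_0_lt_compat|apply pow2_ge_0]).
    lra. }
  nra.
Qed.

(** Here [m] acts as the barycentre of [y] and [g (b + S)]. Curvature bounds distances to [m] from
    below only; the upper bound on [d (g b) m] holds because [g (b + S)] is the midpoint of [g b]
    and [g (b + 2 * S)], so that a lower bound at the far end gives an upper one at the near end. *)
Lemma interior_merge p x g y a b S t :
  geodesic d p x g -> d p x = b + a -> 0 < a -> 0 < b -> 0 < S -> 2 * S <= a ->
  0 <= t <= 1 ->
  let e := 2 * S * d (g b) y ^ 2 * (/ a + / b) in
  exists m, d (g b) m ^ 2 <= stewart d (g b) y (g (b + S)) t + e /\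
    forall z, gram (g b) m z
      <= (1 - t) * gram (g b) y z + t * gram (g b) (g (b + S)) z + e / 2.
Proof.
  intros Hg D Ha Hb HS HSa Ht e.
  destruct (CBB0_contract y (g (b + S)) t Ht) as (m & _ & Em & Hm).
  assert (Hmid := CBB0_along_geodesic _ _ _ m b (b + S) (b + 2 * S) Hg ltac:(lra) ltac:(lra)).
  assert (He := interior_second_difference p x g y a b S Hg D Ha Hb ltac:(lra) HSa).
  assert (Hm2 := Hm (g (b + 2 * S))).
  assert (HS1 : d (g b) (g (b + S)) = S)
    by (rewrite (geodesic_dist d p x g b (b + S) Hg); lra).
  assert (HS2 : d (g (b + S)) (g (b + 2 * S)) = S)
    by (rewrite (geodesic_dist d p x g (b + S) (b + 2 * S) Hg); lra).
  rewrite Em in Hmid; unfold stewart in Hm2.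
  rewrite (dist_sym d Hd _ m), (dist_sym d Hd _ y), (dist_sym d Hd _ (g (b + S))), HS2 in Hm2.
  rewrite (dist_sym d Hd y (g b)) in He; fold e in He.
  rewrite (dist_sym d Hd m (g b)) in Hmid.
  assert (He0 : 0 <= e).
  { unfold e. pose proof (Rinv_0_lt_compat a Ha); pose proof (Rinv_0_lt_compat b Hb).
    apply Rmult_le_pos; [apply Rmult_le_pos; [lra|apply pow2_ge_0]|lra]. }
  assert (Hnear : d (g b) m ^ 2 <= stewart d (g b) y (g (b + S)) t + e).
  { unfold stewart; rewrite HS1.
    set (B := d (g b) y ^ 2) in *; set (Q := d y (g (b + S))) in *.
    set (M := d (g b) m ^ 2) in *; set (M2 := d m (g (b + 2 * S)) ^ 2) in *.
    set (Y2 := d y (g (b + 2 * S)) ^ 2) in *.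
    assert (Hmid' : M <= 2 * ((1 - t) * Q) ^ 2 + 2 * S ^ 2 - M2).
    { apply Rmult_le_reg_l with S; [lra|]. nra. }
    assert ((1 - t) * (2 * Q ^ 2 + 2 * S ^ 2 - B - Y2) <= (1 - t) * e)
      by (apply Rmult_le_compat_l; lra).
    nra. }
  exists m; split; [exact Hnear|].
  intros z; pose proof (Hm z) as Hz; unfold stewart in *; unfold gram.
  rewrite (dist_sym d Hd m z), (dist_sym d Hd y z), (dist_sym d Hd (g (b + S)) z).
  lra.
Qed.

(** Serves to pass from interior base points to arbitrary ones by letting [b] tend to 0. *)
Lemma gram_continuous p p' x y b : d p p' = b -> b <= 1 ->
  gram p' x y <= gram p x y + b * (d p x + d p y + 1).
Proof.
  intros Hb Hb1. unfold gram.
  pose proof (dist_nonneg d Hd p p') as H0; rewrite Hb in H0.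
  assert (H : forall z, d p' z ^ 2 <= d p z ^ 2 + b * (2 * d p z + 1)).
  { intros z. pose proof (dist_triangle d Hd p' p z) as Hz.
    rewrite (dist_sym d Hd p' p), Hb in Hz.
    pose proof (dist_nonneg d Hd p' z). pose proof (dist_nonneg d Hd p z). nra. }
  pose proof (H x); pose proof (H y); lra.
Qed.

(** The form of the points contracted by [s] is at most [s ^ 2] times the original one. It is at
    least the form of the merged list, nonnegative by [IH], minus [s ^ 2 * (K * s)]. Divide by
    [s ^ 2] and let [s] tend to 0. *)
Lemma qform_gram_at_interior p x1 w1 x2 w2 L g b :
  (forall M : list (R * X), length M = length L -> nonneg M ->
    forall w x z, 0 <= w -> 0 <= qform (gram z) ((w, x) :: M)) ->
  geodesic d p x1 g -> 0 < b < d p x1 -> 0 < w1 -> 0 <= w2 -> nonneg L ->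
  0 <= qform (gram (g b)) ((w1, x1) :: (w2, x2) :: L).
Proof.
  intros IH Hg Hb Hw1 Hw2 HL.
  set (a := d p x1 - b).
  set (p' := g b).
  set (W := wsum L (fun _ => 1)).
  set (K := (w1 + w2) * (w1 + w2 + W) * (2 * a * d p' x2 ^ 2 * (/ a + / b))).
  apply (Rle_of_forall_small 0 _ K (/ 2)); [lra|]; intros s Hs.
  assert (Ea : d p' x1 = a).
  { unfold p'; rewrite <- (proj1 (proj2 Hg)) at 1.
    apply (geodesic_dist d p x1 g b (d p x1) Hg); lra. }
  (* [x1] must go to a point of [g] itself, since merging needs a geodesic continuing beyond it; any
     contraction towards [p'] will do for the other points. *)
  assert (Hsh : exists sh : X -> X, sh x1 = g (b + s * a) /\ forall x,
    d p' (sh x) = s * d p' x /\ forall z, stewart d z p' x s <= d z (sh x) ^ 2).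
  { destruct (@boolp.choice _ _ (fun x m => (x = x1 -> m = g (b + s * a)) /\
      d p' m = s * d p' x /\ forall z, stewart d z p' x s <= d z m ^ 2)) as [sh H].
    - intros x; destruct (classic (x = x1)) as [->|Hx].
      + exists (g (b + s * a)); split; [reflexivity|split].
        * unfold p'; rewrite (geodesic_dist d p x1 g b (b + s * a) Hg); fold p';
            rewrite ?Ea; unfold a in *; nra.
        * intros z.
          assert (H := CBB0_along_geodesic p x1 g z b (b + s * a) (d p x1) Hg
            ltac:(unfold a; nra) ltac:(unfold a; nra)).
          rewrite (proj1 (proj2 Hg)) in H.
          unfold stewart; fold p' in H; rewrite Ea.
          replace (d p x1) with (b + a) in H by (unfold a; ring).
          apply Rmult_le_reg_l with a; [unfold a; lra|]. lra.
      + destruct (CBB0_contract p' x s ltac:(lra)) as (m & H1 & _ & H2).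
        exists m; tauto.
    - exists sh; split; [now apply (H x1)|]. intros x; apply (H x). }
  destruct Hsh as (sh & Hsh1 & Hsh).
  set (M := map (fun wx : R * X => (fst wx, sh (snd wx))) L).
  assert (HM : nonneg M) by now apply nonneg_map.
  assert (HW : wsum M (fun _ => 1) = W) by (unfold M; now rewrite wsum_map).
  assert (HW0 : 0 <= W) by (apply wsum_nonneg; [exact HL|intros; lra]).
  assert (Hshrink : qform (gram p') ((w1, sh x1) :: (w2, sh x2) :: M)
    <= s ^ 2 * qform (gram p') ((w1, x1) :: (w2, x2) :: L)).
  { change ((w1, sh x1) :: (w2, sh x2) :: M) with
      (map (fun wx : R * X => (fst wx, sh (snd wx))) ((w1, x1) :: (w2, x2) :: L)).
    rewrite qform_map, <- qform_scal.
    apply qform_le; [repeat apply nonneg_cons; auto; lra|].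
    intros x y; destruct (Hsh x), (Hsh y); apply gram_contract; auto; lra. }
  set (t := w1 / (w1 + w2)).
  assert (Et : t * (w1 + w2) = w1) by (unfold t; field; lra).
  assert (Ht : 0 <= t <= 1) by (split; nra).
  destruct (interior_merge p x1 g (sh x2) a b (s * a) t Hg) as (m & Hm1 & Hm2);
    try solve [exact Ht | unfold a; nra].
  fold p' in Hm1, Hm2; rewrite <- Hsh1 in Hm1, Hm2; rewrite (proj1 (Hsh x2)) in Hm1, Hm2.
  set (e := 2 * (s * a) * (s * d p' x2) ^ 2 * (/ a + / b)) in *.
  assert (Hmerged := IH M (length_map _ _) HM (w1 + w2) m p' ltac:(lra)).
  assert (Hcross : wsum M (gram p' m) <= (1 - t) * wsum M (gram p' (sh x2))
    + t * wsum M (gram p' (sh x1)) + e / 2 * W).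
  { rewrite <- HW, <- wsum_const, <- !wsum_scal, <- !wsum_plus.
    now apply wsum_le. }
  set (Q := qform (gram p') ((w1, x1) :: (w2, x2) :: L)) in *.
  rewrite !qform_cons in Hmerged by apply gram_sym.
  rewrite !qform_cons in Hshrink by apply gram_sym. simpl wsum in Hshrink.
  rewrite !gram_diag in *.
  (* With this [t], Stewart's formula reproduces the two-point form exactly; merging loses only the
     terms in [e]. *)
  assert (Hexact : (w1 + w2) ^ 2 * stewart d p' (sh x2) (sh x1) t
    = w1 ^ 2 * d p' (sh x1) ^ 2 + 2 * w1 * (w2 * gram p' (sh x1) (sh x2))
      + w2 ^ 2 * d p' (sh x2) ^ 2).
  { unfold stewart, gram; rewrite (dist_sym d Hd (sh x2) (sh x1)).
    unfold t; field; lra. }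
  assert (HK : (w1 + w2) * (w1 + w2 + W) * e = s ^ 2 * (K * s)) by (unfold K, e; ring).
  apply Rmult_le_reg_l with (s ^ 2); [nra|].
  assert ((w1 + w2) ^ 2 * d p' m ^ 2 <= (w1 + w2) ^ 2 * (stewart d p' (sh x2) (sh x1) t + e)).
  { apply Rmult_le_compat_l; [apply pow2_ge_0|].
    now rewrite (proj1 (Hsh x2)) in *. }
  assert (2 * (w1 + w2) * wsum M (gram p' m) <= 2 * w2 * wsum M (gram p' (sh x2))
    + 2 * w1 * wsum M (gram p' (sh x1)) + (w1 + w2) * e * W).
  { replace (2 * w2) with (2 * (w1 + w2) * (1 - t)) by lra.
    replace (2 * w1) with (2 * (w1 + w2) * t) by lra.
    apply (Rmult_le_compat_l (2 * (w1 + w2))) in Hcross; lra. }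
  lra.
Qed.

(** The Lang-Schroeder-Sturm inequality. *)
Lemma qform_gram_nonneg p L : nonneg L -> 0 <= qform (gram p) L.
Proof.
  (* The base point [z] is quantified inside the induction because the step moves it into a
     geodesic. *)
  enough (H : forall n (M : list (R * X)), length M = n -> nonneg M ->
    forall w x z, 0 <= w -> 0 <= qform (gram z) ((w, x) :: M)).
  { intros HL; destruct L as [|[w x] L]; [unfold qform; simpl; lra|].
    inversion HL; subst; eapply H; eauto. }
  clear p L; induction n as [|n IH]; intros M En HM w1 x1 p Hw1.
  { destruct M; [|discriminate]. rewrite qform_cons, gram_diag by apply gram_sym.
    unfold qform; simpl. pose proof (pow2_ge_0 (d p x1)). nra. }
  destruct M as [|[w2 x2] L]; [discriminate|].
  injection En as En; inversion HM as [|? ? Hw2 HL]; subst; simpl in Hw2.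
  assert (Hdrop : 0 <= qform (gram p) ((w2, x2) :: L)) by (apply IH; auto).
  destruct (Req_dec w1 0) as [->|Hw].
  { rewrite qform_cons by apply gram_sym. lra. }
  destruct (Req_dec (d p x1) 0) as [Hpx|Hpx].
  { apply dist_eq in Hpx; [|exact Hd]; subst x1.
    rewrite qform_cons by apply gram_sym.
    rewrite (wsum_ext _ (gram p p) (fun _ => 0)) by apply gram_base.
    rewrite wsum_const, gram_base. lra. }
  pose proof (dist_nonneg d Hd p x1).
  destruct (proj1 Hcbb p x1) as [g Hg].
  apply (Rle_of_forall_small _ _
    (qform (fun x y => d p x + d p y + 1) ((w1, x1) :: (w2, x2) :: L))
    (Rmin 1 (d p x1))); [apply Rmin_glb_lt; lra|].
  intros b Hb. pose proof (Rmin_l 1 (d p x1)); pose proof (Rmin_r 1 (d p x1)).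
  apply Rle_trans with (qform (gram (g b)) ((w1, x1) :: (w2, x2) :: L)).
  { apply (qform_gram_at_interior p); auto; lra. }
  rewrite Rmult_comm, <- qform_scal, <- qform_plus.
  apply qform_le; [repeat apply nonneg_cons; auto|].
  intros x y; apply gram_continuous; [|lra].
  rewrite <- (proj1 Hg) at 1.
  rewrite (geodesic_dist d p x1 g 0 b Hg); lra.
Qed.

End NonnegativeCurvature.

(** * Nonpositive curvature: contractions and intersections of balls *)

Section NonpositiveCurvature.
Context {Y : Type} (d : Y -> Y -> R) (Hd : is_metric d) (Hcat : CAT0 d).

(** Every point is pulled the fraction [t] of the way to [o]; the factor [1 - t] is Stewart's
    inequality tested at [z], [o] and [c y]. *)
Lemma CAT0_contraction (o : Y) (t : R) : 0 <= t <= 1 ->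
  exists c : Y -> Y, (forall y, d y (c y) <= t * d y o) /\
    forall y z, d (c y) (c z) <= (1 - t) * d y z.
Proof.
  intros Ht.
  destruct (@boolp.choice _ _ (fun y m => forall p, d p m ^ 2 <= stewart d p y o t)) as [c Hc].
  { intros y; now apply CAT0_stewart. }
  assert (sq_le : forall a b, 0 <= b -> a ^ 2 <= b ^ 2 -> a <= b) by (intros; nra).
  exists c; split.
  - intros y. pose proof (dist_nonneg d Hd y o) as H0. apply sq_le; [nra|].
    pose proof (Hc y y) as H; unfold stewart in H; rewrite (dist_refl d Hd y) in H. lra.
  - intros y z. pose proof (dist_nonneg d Hd y z) as H0. apply sq_le; [nra|].
    pose proof (Hc z (c y)) as H1; pose proof (Hc y z) as H2; pose proof (Hc y o) as H3.
    unfold stewart in *.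
    rewrite (dist_refl d Hd o) in H3.
    rewrite (dist_sym d Hd (c y) z), (dist_sym d Hd (c y) o) in H1.
    rewrite (dist_sym d Hd z y) in H2. rewrite (dist_sym d Hd o y) in H3.
    assert ((1 - t) * d z (c y) ^ 2
      <= (1 - t) * ((1 - t) * d y z ^ 2 + t * d z o ^ 2 - t * (1 - t) * d y o ^ 2))
      by (apply Rmult_le_compat_l; lra).
    assert (t * d o (c y) ^ 2
      <= t * ((1 - t) * d y o ^ 2 + t * 0 ^ 2 - t * (1 - t) * d y o ^ 2))
      by (apply Rmult_le_compat_l; lra).
    lra.
Qed.

Context {I : Type} (pt : I -> Y) (rho : I -> R).

(** Lower bounds for the problem dual to minimising the supremum over [i] of
    [d z (pt i) ^ 2 - rho i]. Asking for the quadratic growth [d z b ^ 2] makes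
    them stable under geodesics, without constructing barycentres. *)
Definition certificate (b : Y) (v : R) : Prop :=
  exists L : list (R * I), nonneg L /\ wsum L (fun _ => 1) = 1 /\
    forall z, v + d z b ^ 2 <= wsum L (fun i => d z (pt i) ^ 2 - rho i).

Lemma certificate_point i : certificate (pt i) (- rho i).
Proof.
  exists ((1, i) :: nil); split; [|split].
  - apply nonneg_cons; [lra|constructor].
  - simpl; ring.
  - intros z; simpl; lra.
Qed.

(** The gain [t * (1 - t) * d b b' ^ 2] is the last term of Stewart's inequality; it forces nearly
    optimal certificates to have nearby points. *)
Lemma certificate_mix b v b' v' t : 0 <= t <= 1 ->
  certificate b v -> certificate b' v' ->
  exists c, certificate c ((1 - t) * v + t * v' + t * (1 - t) * d b b' ^ 2).
Proof.
  intros Ht (L & HL & HL1 & H) (L' & HL' & HL1' & H').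
  destruct (CAT0_stewart d Hd Hcat b b' t Ht) as [c Hc].
  exists c, (rescale (1 - t) L ++ rescale t L'); split; [|split].
  - apply nonneg_app; apply nonneg_rescale; auto; lra.
  - rewrite wsum_app, !wsum_rescale, HL1, HL1'; ring.
  - intros z; rewrite wsum_app, !wsum_rescale.
    pose proof (Hc z) as Hz; unfold stewart in Hz.
    assert ((1 - t) * (v + d z b ^ 2) <= (1 - t) * wsum L (fun i => d z (pt i) ^ 2 - rho i))
      by (apply Rmult_le_compat_l; [lra|auto]).
    assert (t * (v' + d z b' ^ 2) <= t * wsum L' (fun i => d z (pt i) ^ 2 - rho i))
      by (apply Rmult_le_compat_l; [lra|auto]).
    lra.
Qed.

(** In the application [rho] holds squared distances from a new source point to old ones with images
    [pt]; the partial map being short, this form dominates a Gram form of the source. *)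
Hypothesis Hrho : forall L, nonneg L ->
  0 <= qform (fun i j => rho i + rho j - d (pt i) (pt j) ^ 2) L.

(** Testing the certificate at [b] and at the points [pt i] themselves. *)
Lemma certificate_nonpos b v : certificate b v -> v <= 0.
Proof.
  intros (L & HL & HL1 & H).
  pose proof (H b) as Hb. rewrite (dist_refl d Hd b) in Hb.
  assert (Hpts : wsum L (fun j => v + d b (pt j) ^ 2)
    <= qform (fun j i => d (pt j) (pt i) ^ 2 - rho i) L).
  { apply wsum_le; [exact HL|]. intros j; rewrite (dist_sym d Hd b); apply H. }
  pose proof (Hrho L HL) as HQ.
  assert (E : qform (fun i j => rho i + rho j - d (pt i) (pt j) ^ 2) L
    + qform (fun j i => d (pt j) (pt i) ^ 2 - rho i) L = wsum L rho).
  { rewrite <- qform_plus, (qform_ext _ (fun i _ => rho i)) by (intros; ring).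
    rewrite qform_l, HL1; ring. }
  rewrite wsum_plus, wsum_const, HL1 in Hpts.
  assert (E' : wsum L (fun i => d b (pt i) ^ 2 - rho i)
    = wsum L (fun i => d b (pt i) ^ 2) + -1 * wsum L rho).
  { rewrite <- wsum_scal, <- wsum_plus; apply wsum_ext; intros; ring. }
  lra.
Qed.

Lemma ball_intersection : complete d -> inhabited I ->
  exists y, forall i, d y (pt i) ^ 2 <= rho i.
Proof.
  intros Hcompl [i0].
  destruct (completeness (fun v => exists b, certificate b v)) as [V [HV HVlub]].
  { exists 0; intros v [b Hb]; eapply certificate_nonpos; eauto. }
  { exists (- rho i0), (pt i0); apply certificate_point. }
  assert (HV0 : V <= 0).
  { apply HVlub; intros v [b Hb]; eapply certificate_nonpos; eauto. }
  (* Values within [t n ^ 2] of the supremum [V] leave an error of order [t n] after the division by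
     [t n] below. *)
  pose (t := fun n : nat => / (INR n + 2)).
  assert (Ht : forall n, 0 < t n <= / 2).
  { intros n; pose proof (pos_INR n); unfold t; split.
    - apply Rinv_0_lt_compat; lra.
    - apply Rinv_le_contravar; lra. }
  destruct (@boolp.choice _ _ (fun n b => exists v, certificate b v /\ V - t n ^ 2 < v)) as [b Hb].
  { intros n; apply NNPP; intros Hn.
    assert (V <= V - t n ^ 2); [|pose proof (Ht n); nra].
    apply HVlub; intros v [b Hb]. apply Rnot_lt_le; intros Hlt.
    apply Hn; exists b, v; auto. }
  assert (Hpair : forall m n, d (b m) (b n) ^ 2 <= 2 * t m ^ 2 + 2 * t n ^ 2).
  { intros m n; destruct (Hb m) as (v & Hv & Hv'), (Hb n) as (w & Hw & Hw').
    (* The midpoint's gain cannot exceed the mean defect of the two values, which makes [b] a Cauchy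
       sequence. *)
    destruct (certificate_mix _ _ _ _ (/ 2) ltac:(lra) Hv Hw) as [c Hc].
    pose proof (HV _ (ex_intro _ c Hc)). lra. }
  assert (Hdecr : forall m n, (m <= n)%nat -> t n <= t m).
  { intros m n Hmn; apply le_INR in Hmn; pose proof (pos_INR m).
    apply Rinv_le_contravar; lra. }
  assert (Hsmall : forall eps, 0 < eps -> exists N, t N < eps).
  { intros eps Heps; destruct (archimed_cor1 eps Heps) as (N & HN & HN').
    exists N; eapply Rlt_trans; [|exact HN].
    apply lt_0_INR in HN'; apply Rinv_lt_contravar; nra. }
  destruct (Hcompl b) as [y Hy].
  { intros eps Heps; destruct (Hsmall (eps / 2) ltac:(lra)) as [N HN].
    exists N; intros m n Hm Hn. apply Hdecr in Hm, Hn.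
    pose proof (Hpair m n); pose proof (Ht m); pose proof (Ht n).
    assert (d (b m) (b n) ^ 2 < eps ^ 2) by nra.
    apply Rnot_le_lt; intros Hle; nra. }
  exists y; intros i.
  (* First-order optimality: mixing a part [t n] of the certificate at [pt i] into that at [b n]
     cannot raise the value above [V <= 0]. *)
  assert (Hi : forall n, (1 - t n) * d (b n) (pt i) ^ 2 <= rho i + t n).
  { intros n; destruct (Hb n) as (v & Hv & Hv'). pose proof (Ht n).
    destruct (certificate_mix _ _ _ _ (t n) ltac:(lra) Hv (certificate_point i)) as [c Hc].
    pose proof (HV _ (ex_intro _ c Hc)).
    apply Rmult_le_reg_l with (t n); [lra|].
    assert ((1 - t n) * (V - t n ^ 2) <= (1 - t n) * v) by (apply Rmult_le_compat_l; lra).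
    nra. }
  assert (Hdist : is_lim_seq (fun n => d (b n) (pt i)) (d y (pt i))).
  { apply is_lim_seq_spec; intros eps; destruct (Hy eps (cond_pos eps)) as [N HN].
    exists N; intros n Hn; specialize (HN n Hn).
    pose proof (dist_triangle d Hd (b n) y (pt i)).
    pose proof (dist_triangle d Hd y (b n) (pt i)) as H'.
    rewrite (dist_sym d Hd y (b n)) in H'.
    apply Rabs_def1; lra. }
  assert (Htlim : is_lim_seq t 0).
  { apply is_lim_seq_spec; intros eps; destruct (Hsmall eps (cond_pos eps)) as [N HN].
    exists N; intros n Hn; apply Hdecr in Hn; pose proof (Ht n).
    rewrite Rminus_0_r, Rabs_pos_eq; lra. }
  assert (Hl : is_lim_seq (fun n => (1 - t n) * d (b n) (pt i) ^ 2)
    ((1 - 0) * (d y (pt i) * (d y (pt i) * 1)))).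
  { apply is_lim_seq_mult'.
    - apply is_lim_seq_minus'; [apply is_lim_seq_const|exact Htlim].
    - apply is_lim_seq_mult'; [exact Hdist|].
      apply is_lim_seq_mult'; [exact Hdist|apply is_lim_seq_const]. }
  assert (Hr : is_lim_seq (fun n => rho i + t n) (rho i + 0))
    by (apply is_lim_seq_plus'; [apply is_lim_seq_const|exact Htlim]).
  pose proof (is_lim_seq_le _ _ _ _ Hi Hl Hr) as H; simpl in H; lra.
Qed.

End NonpositiveCurvature.

(** * Kirszbraun extension by Zorn's lemma *)

(** Here [k] stands for a squared distance. *)
Definition gram_nonneg {Z : Type} (k : Z -> Z -> R) : Prop :=
  forall p L, nonneg L -> 0 <= qform (fun x y => k p x + k p y - k x y) L.

(** The partial map is a relation, so that two layers can be prescribed together; [k z z = 0] makes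
    it single valued. [ball_intersection] adds one point, Zorn's lemma the rest. *)
Lemma extension_of_relation {Z Y : Type} (k : Z -> Z -> R) (d : Y -> Y -> R)
  (G : Z -> Y -> Prop) :
  is_metric d -> CAT0 d -> complete d ->
  (forall z, k z z = 0) -> (forall z z', k z z' = k z' z) -> gram_nonneg k ->
  (exists z y, G z y) ->
  (forall z y z' y', G z y -> G z' y' -> d y y' ^ 2 <= k z z') ->
  exists h : Z -> Y, (forall z y, G z y -> h z = y) /\
    forall z z', d (h z) (h z') ^ 2 <= k z z'.
Proof.
  intros Hd Hcat Hcompl Hk0 Hksym Hk (z0 & y0 & Hz0) HG.
  set (short := fun E : Z * Y -> Prop => forall u v, E u -> E v ->
    d (snd u) (snd v) ^ 2 <= k (fst u) (fst v)).
  (* Only the added pairs [B] are ordered; the empty chain is then covered by the shortness of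
     [G]. *)
  destruct (@classical_sets.Zorn_bigcup (Z * Y)
    (fun B => short (fun u => G (fst u) (snd u) \/ B u))) as (B & HB & Hmax).
  { intros F HF Htot.
    assert (key : forall u v, (exists2 C, F C & C u) -> (exists2 C, F C & C v) ->
      exists2 C, F C & C u /\ C v).
    { intros u v [C FC Cu] [C' FC' Cv]. destruct (Htot C C' FC FC') as [S|S].
      - exists C'; auto.
      - exists C; auto. }
    intros u v [Gu|Fu] [Gv|Fv].
    - now apply HG.
    - destruct Fv as [C FC Cv]. apply (HF C FC u v); auto.
    - destruct Fu as [C FC Cu]. apply (HF C FC u v); auto.
    - destruct (key u v Fu Fv) as [C FC [Cu Cv]]. apply (HF C FC u v); auto. }
  set (E := fun u : Z * Y => G (fst u) (snd u) \/ B u) in *.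
  assert (Hpoint : forall p, exists y, forall u, E u -> d y (snd u) ^ 2 <= k p (fst u)).
  { intros p.
    destruct (ball_intersection d Hd Hcat
      (fun u : {u : Z * Y | E u} => snd (proj1_sig u))
      (fun u => k p (fst (proj1_sig u)))) as [y Hy].
    - intros L HL.
      pose proof (Hk p _ (nonneg_map (fun u : {u : Z * Y | E u} => fst (proj1_sig u)) L HL)) as H.
      rewrite qform_map in H. eapply Rle_trans; [exact H|].
      apply qform_le; [exact HL|]. intros [u Hu] [v Hv]; simpl.
      pose proof (HB u v Hu Hv); lra.
    - exact Hcompl.
    - constructor; exists (z0, y0); left; exact Hz0.
    - exists y; intros u Hu; exact (Hy (exist _ u Hu)). }
  destruct (boolp.choice Hpoint) as [h Hh].
  (* [h] is chosen pointwise against the fixed maximal [E]; maximality puts its whole graph into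
     [E], so its values are mutually compatible. *)
  assert (HE : forall p, E (p, h p)).
  { intros p; apply NNPP; intros Hn.
    apply (Hmax (fun u => B u \/ u = (p, h p))).
    - split; [now left|]. intros Hsub; apply Hn; right; apply Hsub; now right.
    - assert (Hnew : forall u, E u ->
        d (snd u) (snd (p, h p)) ^ 2 <= k (fst u) (fst (p, h p))).
      { intros u Hu; simpl. rewrite (dist_sym d Hd), Hksym; now apply Hh. }
      intros u v Hu Hv.
      assert (Hu' : E u \/ u = (p, h p)) by (unfold E; tauto).
      assert (Hv' : E v \/ v = (p, h p)) by (unfold E; tauto).
      destruct Hu' as [Hu'| ->], Hv' as [Hv'| ->]; auto.
      + rewrite (dist_sym d Hd), Hksym; auto.
      + rewrite (dist_refl d Hd), Hk0; simpl; lra. }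
  exists h; split.
  - intros z y Hzy. apply (dist_eq d Hd).
    pose proof (HB (z, h z) (z, y) (HE z) (or_introl Hzy)) as H; simpl in H.
    rewrite Hk0 in H. pose proof (dist_nonneg d Hd (h z) y). nra.
  - intros z z'. exact (HB (z, h z) (z', h z') (HE z) (HE z')).
Qed.

(** The Gram form splits, the real coordinate contributing twice a square. The factor [c] replaces a
    rescaling of the metric, so that [c = 0] is included. *)
Lemma gram_nonneg_affine_line {X : Type} (d : X -> X -> R) (c : R) :
  is_metric d -> CBB0 d ->
  gram_nonneg (fun u v : X * R => c ^ 2 * d (fst u) (fst v) ^ 2 + (snd u - snd v) ^ 2).
Proof.
  intros Hd Hcbb [p s] L HL; simpl fst; simpl snd.
  rewrite (qform_ext _ (fun u v => 2 * c ^ 2 * gram d p (fst u) (fst v)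
    + 2 * ((snd u - s) * (snd v - s)))) by (intros; unfold gram; field).
  rewrite qform_plus, !qform_scal, qform_mul.
  pose proof (qform_gram_nonneg d Hd Hcbb p _ (nonneg_map fst L HL)) as H.
  rewrite qform_map in H. pose proof (pow2_ge_0 c).
  pose proof (Rle_0_sqr (wsum L (fun u => snd u - s))) as Hs; unfold Rsqr in Hs.
  assert (0 <= c ^ 2 * qform (fun x y => gram d p (fst x) (fst y)) L)
    by (apply Rmult_le_pos; auto).
  lra.
Qed.

(** * Lipschitz constants and the supremum distance *)

Lemma is_metric_dsub {X : Type} (d : X -> X -> R) (A : X -> Prop) :
  is_metric d -> is_metric (dsub d A).
Proof.
  intros Hd; unfold dsub; split; [|split; [|split]].
  - intros; now apply dist_nonneg.
  - intros [x Hx] [y Hy]; simpl; split.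
    + intros E; apply (dist_eq d Hd) in E; subst y; f_equal; apply proof_irrelevance.
    + intros E; injection E as ->; now apply dist_refl.
  - intros; now apply dist_sym.
  - intros; now apply dist_triangle.
Qed.

Lemma Lip_spec {S Y : Type} (dS : S -> S -> R) (dY : Y -> Y -> R) (f : S -> Y) :
  is_metric dS -> is_metric dY -> bounded_lipschitz dS dY f ->
  exists c, Lip dS dY f = Finite c /\ 0 <= c /\
    (forall x y, dY (f x) (f y) <= c * dS x y) /\
    (forall K, 0 <= K -> (forall x y, dY (f x) (f y) <= K * dS x y) -> c <= K).
Proof.
  intros HS HY [_ [K0 HK0]]. unfold Lip.
  set (E := fun r => r = 0 \/ exists x y, x <> y /\ r = dY (f x) (f y) / dS x y).
  destruct (Lub_Rbar_correct E) as [Hub Hlub].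
  assert (HE : forall K, 0 <= K -> (forall x y, dY (f x) (f y) <= K * dS x y) ->
    is_ub_Rbar E K).
  { intros K HK H r [->|(x & y & Hxy & ->)]; simpl; [exact HK|].
    pose proof (dist_nonneg dS HS x y).
    assert (dS x y <> 0) by (intros E0; apply Hxy; now apply (dist_eq dS HS)).
    apply Rmult_le_reg_r with (dS x y); [lra|].
    unfold Rdiv; rewrite Rmult_assoc, Rinv_l, Rmult_1_r; auto. }
  assert (H0 : Rbar_le 0 (Lub_Rbar E)) by (apply Hub; now left).
  (* [K0] may be negative when all distances vanish. *)
  assert (HK : is_ub_Rbar E (Rabs K0)).
  { apply HE; [apply Rabs_pos|]. intros x y; eapply Rle_trans; [apply HK0|].
    apply Rmult_le_compat_r; [now apply dist_nonneg|apply Rle_abs]. }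
  apply Hlub in HK.
  destruct (Lub_Rbar E) as [c| |]; simpl in *; try contradiction.
  exists c; split; [reflexivity|split; [exact H0|split]].
  - intros x y; destruct (classic (x = y)) as [->|Hxy].
    { rewrite (dist_refl dS HS), (dist_refl dY HY); lra. }
    pose proof (dist_nonneg dS HS x y).
    assert (dS x y <> 0) by (intros E0; apply Hxy; now apply (dist_eq dS HS)).
    assert (Hr : dY (f x) (f y) / dS x y <= c) by (apply (Hub _); right; eauto).
    apply (Rmult_le_compat_r (dS x y)) in Hr; [|lra].
    unfold Rdiv in Hr; rewrite Rmult_assoc, Rinv_l, Rmult_1_r in Hr; auto.
  - intros K HK0' H; exact (Hlub K (HE K HK0' H)).
Qed.

Lemma d_inf_lt_dist {S Y : Type} (dS : S -> S -> R) (dY : Y -> Y -> R)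
  (f g : LipSpace dS dY) (eps : R) :
  Rbar_lt (d_inf dS dY f g) eps -> forall x, dY (proj1_sig f x) (proj1_sig g x) < eps.
Proof.
  intros H x; unfold d_inf in H.
  set (E := fun r => _) in H.
  assert (Hx := proj1 (Lub_Rbar_correct E) (dY (proj1_sig f x) (proj1_sig g x)) (ex_intro _ x eq_refl)).
  exact (Rbar_le_lt_trans _ _ _ Hx H).
Qed.

Lemma d_inf_le {S Y : Type} (dS : S -> S -> R) (dY : Y -> Y -> R)
  (f g : LipSpace dS dY) (r : R) :
  (forall x, dY (proj1_sig f x) (proj1_sig g x) <= r) -> Rbar_le (d_inf dS dY f g) r.
Proof.
  intros H; apply Lub_Rbar_correct; intros s [x ->]; apply H.
Qed.

(** For [c > 0], a pair that [f] stretches by more than [(1 - t) * c] is still so stretched by every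
    [g] near [f]: moving both images by a quarter of the excess uses up at most half of it. *)
Lemma lipschitz_constant_lsc {S Y : Type} (dS : S -> S -> R) (dY : Y -> Y -> R)
  (f : S -> Y) (c t : R) :
  is_metric dS -> is_metric dY -> 0 <= c -> 0 < t <= 1 ->
  (forall K, 0 <= K -> (forall x y, dY (f x) (f y) <= K * dS x y) -> c <= K) ->
  exists delta, 0 < delta /\ forall g, (forall x, dY (f x) (g x) <= delta) ->
    forall K, 0 <= K -> (forall x y, dY (g x) (g y) <= K * dS x y) -> (1 - t) * c <= K.
Proof.
  intros HS HY Hc Ht Hmin.
  destruct (Req_dec c 0) as [->|Hc0]; [exists 1; split; [lra|intros; lra]|].
  assert (Hex : exists x y, (1 - t) * c * dS x y < dY (f x) (f y)).
  { apply NNPP; intros Hn. enough (c <= (1 - t) * c) by nra.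
    apply Hmin; [nra|]. intros x y; apply Rnot_lt_le; intros H; apply Hn; eauto. }
  destruct Hex as (x & y & Hxy).
  exists ((dY (f x) (f y) - (1 - t) * c * dS x y) / 4); split; [lra|].
  intros g Hg K HK H. apply Rnot_lt_le; intros Hlt.
  pose proof (Hg x) as Hx; pose proof (Hg y) as Hy; pose proof (H x y).
  pose proof (dist_triangle dY HY (f x) (g x) (f y)).
  pose proof (dist_triangle dY HY (g x) (g y) (f y)).
  rewrite (dist_sym dY HY (f y)) in Hy.
  pose proof (dist_nonneg dS HS x y).
  assert (K * dS x y <= (1 - t) * c * dS x y) by (apply Rmult_le_compat_r; lra).
  lra.
Qed.

(** * Extensions close to a given map, and lower semi-continuity *)

Lemma extension_near {X Y : Type} (dX : X -> X -> R) (dY : Y -> Y -> R) (A : X -> Prop)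
  (g : {x | A x} -> Y) (F : X -> Y) (c M rho tau : R) :
  is_metric dX -> CBB0 dX -> is_metric dY -> CAT0 dY -> complete dY ->
  (exists a, A a) ->
  (forall a b, dY (g a) (g b) <= c * dsub dX A a b) ->
  (forall x y, dY (F x) (F y) <= c * dX x y) ->
  (forall x y, dY (F x) (F y) <= M) ->
  (forall a, dY (g a) (F (proj1_sig a)) <= rho) ->
  0 <= c -> 0 <= rho -> 0 <= tau -> rho * (2 * M + rho) <= tau ^ 2 ->
  exists g' : X -> Y, (forall a, g' (proj1_sig a) = g a) /\
    (forall x y, dY (g' x) (g' y) <= c * dX x y) /\
    (forall x, dY (g' x) (F x) <= tau).
Proof.
  intros HX Hcbb HY Hcat Hcompl [a0 Ha0] Hg HF HM Hrho Hc Hrho0 Htau Hsmall.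
  set (k := fun u v : X * R => c ^ 2 * dX (fst u) (fst v) ^ 2 + (snd u - snd v) ^ 2).
  set (G := fun (u : X * R) y =>
    (exists a : {x | A x}, u = (proj1_sig a, 0) /\ y = g a) \/
    (exists x, u = (x, tau) /\ y = F x)).
  assert (sq_lip : forall D e, 0 <= D -> D <= c * e -> D ^ 2 <= c ^ 2 * e ^ 2).
  { intros D e HD H; rewrite <- Rpow_mult_distr; apply pow_incr; auto. }
  assert (sq_le : forall u v, 0 <= v -> u ^ 2 <= v ^ 2 -> u <= v) by (intros; nra).
  (* Shortness between the layers: [(rho + h) ^ 2] exceeds [h ^ 2] by [rho * (2 * h + rho)], which
     [h <= M] keeps below [tau ^ 2]. *)
  assert (Hcross : forall a x, dY (g a) (F x) ^ 2 <= c ^ 2 * dX (proj1_sig a) x ^ 2 + tau ^ 2).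
  { intros a x.
    pose proof (dist_triangle dY HY (g a) (F (proj1_sig a)) (F x)) as Htri.
    pose proof (Hrho a) as Ha. pose proof (HM (proj1_sig a) x) as HMx.
    pose proof (dist_nonneg dY HY (g a) (F x)) as H0.
    pose proof (dist_nonneg dY HY (F (proj1_sig a)) (F x)) as H1.
    pose proof (sq_lip _ _ H1 (HF (proj1_sig a) x)) as H2.
    set (h := dY (F (proj1_sig a)) (F x)) in *.
    assert (dY (g a) (F x) ^ 2 <= (rho + h) ^ 2) by (apply pow_incr; lra).
    assert (rho * (2 * h + rho) <= rho * (2 * M + rho)) by (apply Rmult_le_compat_l; lra).
    lra. }
  destruct (extension_of_relation k dY G HY Hcat Hcompl) as (h & Hh & Hshort).
  - intros u; unfold k; rewrite (dist_refl dX HX); ring.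
  - intros u v; unfold k; rewrite (dist_sym dX HX); ring.
  - now apply gram_nonneg_affine_line.
  - exists (a0, tau), (F a0); right; eauto.
  - intros u y u' y' [(a & -> & ->)|(x & -> & ->)] [(b & -> & ->)|(z & -> & ->)];
      unfold k; cbn [fst snd].
    + pose proof (sq_lip _ _ (dist_nonneg dY HY _ _) (Hg a b)) as H; unfold dsub in H; lra.
    + pose proof (Hcross a z); lra.
    + rewrite (dist_sym dY HY), (dist_sym dX HX). pose proof (Hcross b x); lra.
    + pose proof (sq_lip _ _ (dist_nonneg dY HY _ _) (HF x z)); lra.
  - exists (fun x => h (x, 0)); split; [|split].
    + intros a; apply Hh; left; eauto.
    + intros x y; apply sq_le; [apply Rmult_le_pos; [lra|now apply dist_nonneg]|].
      pose proof (Hshort (x, 0) (y, 0)) as H; unfold k in H; cbn [fst snd] in H. lra.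
    + intros x; apply sq_le; [exact Htau|].
      rewrite <- (Hh (x, tau) (F x)) by (right; eauto).
      pose proof (Hshort (x, 0) (x, tau)) as H; unfold k in H; cbn [fst snd] in H.
      rewrite (dist_refl dX HX) in H; lra.
Qed.

Theorem theorem3p4 (X Y : Type) (dX : X -> X -> R) (dY : Y -> Y -> R) (A : X -> Prop) :
  is_metric dX -> CBB0 dX ->
  is_metric dY -> CAT0 dY -> complete dY ->
  (exists a, A a) ->
  lsc (d_inf (dsub dX A) dY) (d_inf dX dY) (Psi dX dY A).
Proof.
  intros HX Hcbb HY Hcat Hcompl HA V HV f (f' & [Hext HLip] & Vf').
  destruct (HV f' Vf') as (eps & Heps & Hball).
  pose proof (is_metric_dsub dX A HX) as HXA.
  destruct (Lip_spec _ _ _ HXA HY (proj2_sig f)) as (c & Ec & Hc & _ & Hcmin).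
  destruct (Lip_spec _ _ _ HX HY (proj2_sig f')) as (c' & Ec' & _ & HF & _).
  assert (c' = c) by congruence; subst c'.
  destruct HA as [a0 Ha0]. destruct (proj1 (proj2_sig f')) as [M HM].
  set (F := proj1_sig f') in *.
  pose proof (HM a0 a0) as HM0. rewrite (dist_refl dY HY) in HM0.
  set (tau := eps / 4). assert (Htau : 0 < tau) by (unfold tau; lra).
  (* [rho <= 1] gives [rho * (2 * M + rho) <= tau ^ 2]; [rho <= tau] keeps the final map within
     [2 * tau < eps] of [F]. *)
  set (rho := Rmin (Rmin 1 tau) (tau ^ 2 / (2 * M + 1))).
  assert (Hq : 0 < tau ^ 2 / (2 * M + 1)) by (apply Rdiv_lt_0_compat; nra).
  assert (Hrho : 0 < rho) by (repeat apply Rmin_glb_lt; lra).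
  assert (Hrho1 : rho <= Rmin 1 tau) by apply Rmin_l.
  pose proof (Rmin_l 1 tau) as Hm1; pose proof (Rmin_r 1 tau) as Hm2.
  assert (Hrho2 : rho * (2 * M + 1) <= tau ^ 2).
  { replace (tau ^ 2) with (tau ^ 2 / (2 * M + 1) * (2 * M + 1)) by (field; lra).
    apply Rmult_le_compat_r; [lra|apply Rmin_r]. }
  (* The contraction moves values of [F] by at most [t * M <= rho / 2]; [M + 1] avoids a zero
     denominator. *)
  set (t := Rmin (/ 2) (rho / (2 * (M + 1)))).
  assert (Ht : 0 < t) by (apply Rmin_glb_lt; [lra|apply Rdiv_lt_0_compat; lra]).
  assert (Ht1 : t <= / 2) by apply Rmin_l.
  assert (HtM : t * M <= rho / 2).
  { apply Rle_trans with (t * (M + 1)); [nra|].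
    replace (rho / 2) with (rho / (2 * (M + 1)) * (M + 1)) by (field; lra).
    apply Rmult_le_compat_r; [lra|apply Rmin_r]. }
  destruct (lipschitz_constant_lsc _ _ _ c t HXA HY Hc ltac:(lra) Hcmin)
    as (delta & Hdelta & Hlsc).
  (* Half of [rho] pays for replacing [f] by [g], half for contracting [F]; [delta] secures
     [(1 - t) * c <= l]. *)
  exists (Rmin (rho / 2) delta); split; [apply Rmin_glb_lt; lra|].
  intros g Hg.
  assert (Hfg : forall a, dY (proj1_sig f a) (proj1_sig g a) < Rmin (rho / 2) delta)
    by exact (d_inf_lt_dist _ _ _ _ _ Hg).
  pose proof (Rmin_l (rho / 2) delta) as Hd1; pose proof (Rmin_r (rho / 2) delta) as Hd2.
  destruct (Lip_spec _ _ _ HXA HY (proj2_sig g)) as (l & El & Hl & Hgl & Hgmin).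
  assert (Hcl : (1 - t) * c <= l).
  { apply (Hlsc (proj1_sig g)); auto. intros a; pose proof (Hfg a); lra. }
  (* Contracting [F] makes room for a Lipschitz constant of [g] smaller than that of [f]. *)
  destruct (CAT0_contraction dY HY Hcat (F a0) t ltac:(lra)) as (ctr & Hctr1 & Hctr2).
  assert (HFctr : forall x, dY (F x) (ctr (F x)) <= rho / 2).
  { intros x; eapply Rle_trans; [apply Hctr1|].
    apply Rle_trans with (t * M); [|exact HtM].
    apply Rmult_le_compat_l; [lra|apply HM]. }
  destruct (extension_near dX dY A (proj1_sig g) (fun x => ctr (F x)) l M rho tau)
    as (g' & Hg'ext & Hg'lip & Hg'near); auto; try lra.
  { now exists a0. }
  { intros x y; eapply Rle_trans; [apply Hctr2|].
    pose proof (dist_nonneg dX HX x y).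
    assert ((1 - t) * dY (F x) (F y) <= (1 - t) * (c * dX x y))
      by (apply Rmult_le_compat_l; [lra|apply HF]).
    assert ((1 - t) * c * dX x y <= l * dX x y) by (apply Rmult_le_compat_r; lra).
    lra. }
  { intros x y; eapply Rle_trans; [apply Hctr2|].
    pose proof (HM x y); pose proof (dist_nonneg dY HY (F x) (F y)). nra. }
  { intros a.
    pose proof (dist_triangle dY HY (proj1_sig g a) (F (proj1_sig a)) (ctr (F (proj1_sig a)))).
    pose proof (HFctr (proj1_sig a)). pose proof (Hfg a) as Ha.
    rewrite <- Hext, (dist_sym dY HY) in Ha. fold F in Ha. lra. }
  { nra. }
  assert (Hclose : forall x, dY (F x) (g' x) <= 2 * tau).
  { intros x. pose proof (dist_triangle dY HY (F x) (ctr (F x)) (g' x)) as H.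
    rewrite (dist_sym dY HY (ctr (F x))) in H.
    pose proof (HFctr x); pose proof (Hg'near x); lra. }
  assert (Hbl : bounded_lipschitz dX dY g').
  { split; [|now exists l]. exists (4 * tau + M); intros x y.
    pose proof (dist_triangle dY HY (g' x) (F x) (g' y)) as H1.
    pose proof (dist_triangle dY HY (F x) (F y) (g' y)) as H2.
    rewrite (dist_sym dY HY (g' x) (F x)) in H1.
    pose proof (Hclose x); pose proof (Hclose y); pose proof (HM x y); lra. }
  exists (exist _ g' Hbl); split; [split|].
  - exact Hg'ext.
  - simpl proj1_sig; rewrite El.
    (* The bound by [l] holds by construction; conversely a Lipschitz constant of [g'] is one of its
       restriction [g]. *)
    destruct (Lip_spec _ _ _ HX HY Hbl) as (l' & -> & Hl' & Hgl' & Hmin').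
    f_equal; apply Rle_antisym; [now apply Hmin'|].
    apply Hgmin; [exact Hl'|]. intros a b; rewrite <- !Hg'ext; apply Hgl'.
  - apply Hball. apply Rbar_le_lt_trans with (2 * tau).
    + apply d_inf_le; exact Hclose.
    + simpl; unfold tau; lra.
Qed.
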